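(* Let $0<\varepsilon,\delta,\nu\le 1$, let $a<b$ be real, let $V,A_1:[a,b]\to\mathbb{R}$ be real-valued functions, and let $\Phi_0:[a,b]\to\mathbb{C}^2$ satisfy $\Phi_0(a)=\Phi_0(b)$ and $\Phi_0'(a)=\Phi_0'(b)$. Let $M$ be an even positive integer, $h=\frac{b-a}{M}$ and $x_j=a+jh$ for $0\le j\le M$. For any time step $\tau>0$, let $\Phi^n=(\Phi^n_0,\dots,\Phi^n_M)^T$ ($n\ge 0$) be the sequence produced by the fourth-order compact time-splitting Fourier pseudospectral ($S_{\rm 4c}$) method described in the context, with initial value $\Phi^0_j=\Phi_0(x_j)$, $0\le j\le M$. Then the method conserves the mass in the discretized level, i.e. for all $n\ge 0$, $$\|\Phi^{n+1}\|_{l^2}^2:=h\sum_{j=0}^{M-1}|\Phi^{n+1}_j|^2 = h\sum_{j=0}^{M-1}|\Phi^0_j|^2=h\sum_{j=0}^{M-1}|\Phi_0(x_j)|^2=\|\Phi_0\|_{l^2}^2 .$$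
   Context: The Pauli matrices are $\sigma_1=\begin{pmatrix}0&1\\1&0\end{pmatrix}$, $\sigma_2=\begin{pmatrix}0&-i\\ i&0\end{pmatrix}$, $\sigma_3=\begin{pmatrix}1&0\\0&-1\end{pmatrix}$; $I_2$ is the $2\times2$ identity; $|\cdot|$ is the Euclidean norm on $\mathbb{C}^2$; $i=\sqrt{-1}$. The scheme discretizes the one-dimensional Dirac equation $$i\delta\,\partial_t\Phi=\Big(-i\tfrac{\delta}{\varepsilon}\sigma_1\partial_x+\tfrac{\nu}{\varepsilon^2}\sigma_3\Big)\Phi+\big(V(x)I_2-A_1(x)\sigma_1\big)\Phi,\quad x\in(a,b),\ t>0,$$ with periodic boundary conditions $\Phi(t,a)=\Phi(t,b)$, $\partial_x\Phi(t,a)=\partial_x\Phi(t,b)$ and initial condition $\Phi(0,x)=\Phi_0(x)$. Discrete Fourier coefficients: for $U=(U_0,\dots,U_M)^T$ with $U_j\in\mathbb{C}^2$ and $U_0=U_M$, set $$\widetilde U_l=\frac1M\sum_{j=0}^{M-1}U_j\,e^{-2ijl\pi/M},\qquad l=-\tfrac M2,\dots,\tfrac M2-1,$$ and let $\mu_l=\frac{2\pi l}{b-a}$. Define the $2\times2$ matrices $$W(x)=-\frac{i}{\delta}\big(V(x)I_2-A_1(x)\sigma_1\big),\qquad \widehat W(x)=W(x)-\frac{i\nu\tau^2}{12\,\delta^3\varepsilon^2}A_1(x)^2\sigma_3,$$ $$\Gamma_l=-\frac{i\mu_l}{\varepsilon}\sigma_1-\frac{i\nu}{\delta\varepsilon^2}\sigma_3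 .$$ One step $\Phi^n\mapsto\Phi^{n+1}$ of the $S_{\rm 4c}$ method is, for $j=0,1,\dots,M$ (exponentials are matrix exponentials): $$\Phi^{(1)}_j=e^{\frac{\tau}{6}W(x_j)}\Phi^n_j,$$ $$\Phi^{(2)}_j=\sum_{l=-M/2}^{M/2-1}e^{\frac{\tau}{2}\Gamma_l}\,\widetilde{(\Phi^{(1)})}_l\,e^{2ijl\pi/M},$$ $$\Phi^{(3)}_j=e^{\frac{2\tau}{3}\widehat W(x_j)}\Phi^{(2)}_j,$$ $$\Phi^{(4)}_j=\sum_{l=-M/2}^{M/2-1}e^{\frac{\tau}{2}\Gamma_l}\,\widetilde{(\Phi^{(3)})}_l\,e^{2ijl\pi/M},$$ $$\Phi^{n+1}_j=e^{\frac{\tau}{6}W(x_j)}\Phi^{(4)}_j .$$ (The functions $V$ and $A_1$ enter only through their values at the grid points. For vectors with unequal entries at $j=0$ and $j=M$ the same formula for $\widetilde U_l$, which uses only $j=0,\dots,M-1$, is applied.) *)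

(* Defs.v *)
From HB Require Import structures.
From mathcomp Require Import all_boot all_order all_algebra.
From mathcomp Require Import complex.
From mathcomp Require Import all_classical all_reals all_analysis.

Set Implicit Arguments.
Unset Strict Implicit.
Unset Printing Implicit Defensive.

Import Order.TTheory GRing.Theory Num.Theory.
Import numFieldNormedType.Exports.

Local Open Scope classical_set_scope.
Local Open Scope ring_scope.
Local Open Scope complex_scope.

(* The analysis library provides the modulus topology for abstract number
   fields only; these instances register it on the concrete type R[i]. *)
#[non_forgetful_inheritance]
HB.instance Definition _ (R : realType) := PseudoPointedMetric.copy R[i] R[i]^o.
#[non_forgetful_inheritance]
HB.instance Definition _ (R : realType) := NormedModule.copy R[i] R[i]^o.

(* e^{i t} *)
Definition expi (R : realType) (t : R) : R[i] := cos t +i* sin t.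

(* The library's limit is total: its value is the sum of the series whenever
   the series converges, which it does for every square complex matrix. *)
Definition mexp (R : realType) (n : nat) (A : 'M[R[i]]_n.+1) : 'M[R[i]]_n.+1 :=
  limn (series (fun k : nat => (k`!%:R : R[i])^-1 *: A ^+ k)).

(* The Euclidean norm; the library's norm on matrices is the sup norm. *)
Definition enorm (R : realType) (n : nat) (v : 'cV[R[i]]_n) : R :=
  Num.sqrt (\sum_(k < n) Normc.normc (v k 0) ^+ 2).

Definition sigma1 (R : realType) : 'M[R[i]]_2 :=
  \matrix_(p, q) (if p == q then 0 else 1).

Definition sigma3 (R : realType) : 'M[R[i]]_2 :=
  \matrix_(p, q) (if p == q then (if p == 0 then 1 else -1) else 0).

(* One-sided derivatives of a function of a real variable with complex vector
   values, for use at the endpoints of its interval of definition. *)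
Definition is_right_derive (R : realType) (n : nat) (f : R -> 'cV[R[i]]_n)
    (x : R) (d : 'cV[R[i]]_n) : Prop :=
  (t^-1)%:C *: (f (x + t) - f x) @[t --> 0^'+] --> d.

Definition is_left_derive (R : realType) (n : nat) (f : R -> 'cV[R[i]]_n)
    (x : R) (d : 'cV[R[i]]_n) : Prop :=
  (t^-1)%:C *: (f (x + t) - f x) @[t --> 0^'-] --> d.

Definition gridfun (R : realType) (M : nat) : Type := 'I_M.+1 -> 'cV[R[i]]_2.

Definition mesh (R : realType) (a b : R) (M : nat) : R := (b - a) / M%:R.

Definition gridpt (R : realType) (a b : R) (M : nat) (j : 'I_M.+1) : R :=
  a + j%:R * mesh a b M.

Definition mass (R : realType) (a b : R) (M : nat) (U : gridfun R M) : R :=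
  mesh a b M * \sum_(j < M) enorm (U (widen_ord (leqnSn M) j)) ^+ 2.

Definition dft (R : realType) (M : nat) (U : gridfun R M) (l : int)
    : 'cV[R[i]]_2 :=
  (M%:R : R[i])^-1 *:
    \sum_(j < M) expi (- (2 * j%:R * l%:~R * pi / M%:R))
                   *: U (widen_ord (leqnSn M) j).

(* For even M, freq k runs through -M/2, ..., M/2 - 1. *)
Definition freq (M : nat) (k : 'I_M) : int := k%:Z - (M./2)%:Z.

Definition mu (R : realType) (a b : R) (l : int) : R :=
  2 * pi * l%:~R / (b - a).

Definition Wmx (R : realType) (delta : R) (V A1 : R -> R) (x : R)
    : 'M[R[i]]_2 :=
  - ('i / delta%:C) *: ((V x)%:C *: 1%:M - (A1 x)%:C *: sigma1 R).

Definition What (R : realType) (eps delta nu tau : R) (V A1 : R -> R) (x : R)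
    : 'M[R[i]]_2 :=
  Wmx delta V A1 x
  - ('i * (nu * tau ^+ 2 / (12 * delta ^+ 3 * eps ^+ 2))%:C
      * (A1 x ^+ 2)%:C) *: sigma3 R.

Definition Gamma (R : realType) (eps delta nu a b : R) (l : int)
    : 'M[R[i]]_2 :=
  - ('i * (mu a b l / eps)%:C) *: sigma1 R
  - ('i * (nu / (delta * eps ^+ 2))%:C) *: sigma3 R.

Definition potential_step (R : realType) (a b : R) (M : nat) (s : R)
    (Q : R -> 'M[R[i]]_2) (U : gridfun R M) : gridfun R M :=
  fun j => mexp (s%:C *: Q (gridpt a b j)) *m U j.

Definition free_step (R : realType) (eps delta nu a b : R) (M : nat) (s : R)
    (U : gridfun R M) : gridfun R M :=
  fun j => \sum_(k < M)
    expi (2 * j%:R * (freq k)%:~R * pi / M%:R)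
      *: (mexp (s%:C *: Gamma eps delta nu a b (freq k)) *m dft U (freq k)).

Definition S4c_step (R : realType) (eps delta nu a b : R) (V A1 : R -> R)
    (M : nat) (tau : R) (U : gridfun R M) : gridfun R M :=
  let W := Wmx delta V A1 in
  let W' := What eps delta nu tau V A1 in
  let U1 := potential_step a b (tau / 6) W U in
  let U2 := free_step eps delta nu a b (tau / 2) U1 in
  let U3 := potential_step a b (2 * tau / 3) W' U2 in
  let U4 := free_step eps delta nu a b (tau / 2) U3 in
  potential_step a b (tau / 6) W U4.

Definition S4c (R : realType) (eps delta nu a b : R) (V A1 : R -> R)
    (Phi0 : R -> 'cV[R[i]]_2) (M : nat) (tau : R) (n : nat) : gridfun R M :=
  iter n (S4c_step eps delta nu a b V A1 tau) (fun j => Phi0 (gridpt a b j)).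

(* Main.v *)
Require Import Defs.
From HB Require Import structures.
From mathcomp Require Import all_boot all_order all_algebra.
From mathcomp Require Import complex.
From mathcomp Require Import all_classical all_reals all_analysis.
From mathcomp Require Import ring lra zify.

Import Order.TTheory GRing.Theory Num.Theory.
Import numFieldNormedType.Exports.

Local Open Scope classical_set_scope.
Local Open Scope ring_scope.
Local Open Scope complex_scope.
Local Open Scope sesquilinear_scope.

(** Each of the five substeps of the scheme preserves the mass, because each
    acts by an isometry of the discrete l2 norm; the invariance of the mass
    then follows by induction on the number of time steps.

    The generators [Wmx], [What] and [Gamma] are i times a Hermitian matrix (a
    real combination of the identity and the Pauli matrices), so they are
    skew-Hermitian, and the exponential of a skew-Hermitian matrix is unitary
    ([mexp_skew_unitary]).  The exponential here is a limit of matrix partial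
    sums, and its unitarity is read off the spectral theorem: a skew-Hermitian
    A is P^* diag(i d) P with P unitary and d real, the partial sums are
    diagonalised by the same P, and on the diagonal they are the scalar series
    of e^{i d}, whose real and imaginary parts are the cosine and sine series.
    Hence the limit exists and equals P^* diag(e^{i d}) P, a product of unitary
    matrices.

    A potential step multiplies the value at each grid point by such a unitary
    matrix.  A free step is a discrete Fourier transform, a unitary matrix on
    each mode, and a Fourier synthesis.  The matrix F of the exponentials
    e^{2 i j l pi / M} satisfies F^* F = F F^* = M (geometric sums of roots of
    unity), so the transform M^-1 F^* divides the squared norm by M
    ([plancherel_dft]) and the synthesis F multiplies it by M
    ([plancherel_synthesis]). *)

(** * Spectral form of skew-Hermitian matrices *)

Section Spectral.
Context {C : numClosedFieldType}.

Lemma trmxC_scale m n (c : C) (A : 'M[C]_(m, n)) :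
  (c *: A)^t* = c^*%R *: A^t*.
Proof. by apply/matrixP => i j; rewrite !mxE rmorphM. Qed.

Lemma trmxC_add m n (A B : 'M[C]_(m, n)) :
  (A + B)^t* = A^t* + B^t*.
Proof. by apply/matrixP => i j; rewrite !mxE rmorphD. Qed.

Lemma unitary_diag_expr n (P : 'M[C]_n.+1) (d : 'rV[C]_n.+1) (k : nat) :
  P \is unitarymx ->
  (P^t* *m diag_mx d *m P) ^+ k
    = P^t* *m diag_mx (map_mx (fun z => z ^+ k) d) *m P.
Proof.
move=> Pu; elim: k => [|k IH].
  have -> : map_mx (fun z : C => z ^+ 0) d = const_mx 1.
    by apply/rowP => i; rewrite !mxE.
  by rewrite diag_const_mx mulmx1 expr0 (mulmx1C (unitarymxP Pu)).
have -> : map_mx (fun z : C => z ^+ k.+1) d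
    = \row_i (map_mx (fun z : C => z ^+ k) d 0 i * d 0 i).
  by apply/rowP => i; rewrite !mxE exprSr.
by rewrite exprSr IH -mulmx_diag -mulmxE !mulmxA mulmxtVK.
Qed.

(** A skew-Hermitian matrix is normal, hence unitarily diagonalisable; the
    diagonal form inherits the skewness, so the eigenvalues are imaginary. *)
Lemma skew_spectral n (A : 'M[C]_n) :
  A^t* = - A ->
  exists2 P : 'M[C]_n, P \is unitarymx &
    exists2 d : 'rV[C]_n, A = P^t* *m diag_mx d *m P &
      forall k, (d 0 k)^*%R = - d 0 k.
Proof.
move=> Askew.
have Anorm : A \is normalmx by apply/normalmxP; rewrite Askew mulmxN mulNmx.
have [[P d] /= Pu AE] := orthomx_spectral_subproof Anorm.
rewrite invmx_unitary// in AE.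
exists P => //; exists d => // k.
have dE : diag_mx d = P *m A *m P^t*.
  by rewrite AE !mulmxA (unitarymxP Pu) mul1mx mulmxtVK.
have : (diag_mx d)^t* = - diag_mx d.
  by rewrite dE !trmx_mul !map_mxM /= trmxCK Askew mulmxA mulmxN mulNmx.
by move/matrixP/(_ k k); rewrite !mxE eqxx !mulr1n.
Qed.

Lemma unitary_diag_entry m n (P : 'M[C]_(m, n)) (d : 'rV[C]_m) p q :
  (P^t* *m diag_mx d *m P) p q = \sum_s (P s p)^*%R * P s q * d 0 s.
Proof.
by rewrite mul_mx_diag mxE; apply: eq_bigr => s _; rewrite !mxE mulrAC.
Qed.

Lemma unitary_conj n (P U : 'M[C]_n) :
  P \is unitarymx -> U \is unitarymx -> P^t* *m U *m P \is unitarymx.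
Proof. by move=> Pu Uu; rewrite !mul_unitarymx// trmxC_unitary. Qed.
End Spectral.

(** * The exponential of a skew-Hermitian matrix is unitary *)

Section MatrixExp.
Context {R : realType}.

Lemma cvg_bigsum (K : numFieldType) (V : normedModType K) (I : Type)
    (r : seq I) (f : I -> nat -> V) (l : I -> V) :
  (forall i, f i @ \oo --> l i) ->
  (fun N => \sum_(i <- r) f i N) @ \oo --> \sum_(i <- r) l i.
Proof.
move=> fl; elim: r => [|i r IH].
  by rewrite big_nil; under eq_fun do rewrite big_nil; exact: cvg_cst.
by rewrite big_cons; under eq_fun do rewrite big_cons; exact: cvgD.
Qed.

Lemma conj_complex (x y : R) : (x +i* y)^*%R = x -i* y.
Proof. by []. Qed.

(** The topology on the complex numbers is that of the modulus, which is at
    most the sum of the absolute values of the two components. *)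
Lemma cvg_complex (f g : nat -> R) (x y : R) :
  f @ \oo --> x -> g @ \oo --> y ->
  (fun n => (f n +i* g n) : R[i]) @ \oo --> (x +i* y : R[i]).
Proof.
move=> fx gy; apply/(@cvgrPdist_lt _ R[i]) => e.
rewrite ltcE /= => /andP[/eqP e0 egt0].
have e20 : 0 < complex.Re e / 2 by rewrite divr_gt0.
have /cvgrPdist_lt/(_ _ e20) fxe := fx.
have /cvgrPdist_lt/(_ _ e20) gye := gy.
near=> n.
rewrite normc_def ltcE /= e0 eqxx /=.
have le_norm (u v : R) : Num.sqrt (u ^+ 2 + v ^+ 2) <= `|u| + `|v|.
  rewrite -(ler_pXn2r (n := 2)) ?nnegrE ?sqrtr_ge0 ?addr_ge0//.
  rewrite sqr_sqrtr ?addr_ge0 ?sqr_ge0// sqrrD !real_normK ?num_real//.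
  by rewrite lerD2r lerDl mulrn_wge0 ?mulr_ge0.
apply: le_lt_trans (le_norm _ _) _.
rewrite [ltRHS]splitr ltrD//.
- by near: n.
- by near: n.
Unshelve. all: by end_near. Qed.

Lemma cvg_mx m n (u : nat -> 'M[R[i]]_(m, n)) (A : 'M[R[i]]_(m, n)) :
  (forall i j, (fun N => u N i j) @ \oo --> A i j) -> u @ \oo --> A.
Proof.
move=> uA; apply/cvg_mx_entourageP => E entE.
near=> N; move=> i j; rewrite inE; move: i j; near: N.
apply: filter_forall => i; apply: filter_forall => j.
by have /cvg_app_entourageP/(_ _ entE) := uA i j.
Unshelve. all: by end_near. Qed.

(** With m the integer half of k, i^k is (-1)^m, times i when k is odd; so the
    k-th exponential term at an imaginary argument has the cosine and sine terms
    as its components. *)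
Lemma exp_coeff_imag (d : R) (k : nat) :
  (k`!%:R : R[i])^-1 * (0 +i* d) ^+ k = cos_coeff d k +i* sin_coeff d k.
Proof.
have -> : (0 +i* d : R[i]) = 'i * d%:C by simpc.
have -> : (k`!%:R : R[i])^-1 = (k`!%:R^-1)%:C by rewrite fmorphV rmorph_nat.
have i_pow : ('i : R[i]) ^+ k
    = ((~~ odd k)%:R * (-1) ^+ k./2) +i* ((odd k)%:R * (-1) ^+ k.-1./2).
  rewrite -{1}(odd_double_half k) exprD -mul2n exprM sqr_i.
  have -> : (-1 : R[i]) ^+ k./2 = ((-1) ^+ k./2)%:C by rewrite rmorphXn rmorphN1.
  case: (boolP (odd k)) => ok /=.
    have -> : k.-1./2 = k./2.
      by rewrite -[in LHS](odd_double_half k) ok /= doubleK.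
    by simpc.
  by rewrite expr0 !mul1r mul0r.
rewrite exprMn i_pow -rmorphXn /cos_coeff /sin_coeff /=.
by simpc; congr Complex; rewrite mulrC.
Qed.

Lemma cvg_exp_imag (d : R) :
  series (fun k => (k`!%:R : R[i])^-1 * (0 +i* d) ^+ k) @ \oo --> expi d.
Proof.
have -> : series (fun k => (k`!%:R : R[i])^-1 * (0 +i* d) ^+ k) =
    (fun N => series (cos_coeff d) N +i* series (sin_coeff d) N).
  apply/funext => N; elim: N => [|N IH]; first by rewrite /series /= !big_geq.
  by rewrite !seriesSr IH exp_coeff_imag.
apply: cvg_complex.
- by rewrite unlock; exact: is_cvg_series_cos_coeff.
- by rewrite unlock; exact: is_cvg_series_sin_coeff.
Qed.

Lemma expiD (s t : R) : expi (s + t) = expi s * expi t.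
Proof.
by rewrite /expi cosD sinD; simpc; rewrite (addrC (cos s * sin t)%R).
Qed.

Lemma expi0 : expi (0 : R) = 1.
Proof. by rewrite /expi cos0 sin0. Qed.

Lemma conj_expi (t : R) : (expi t)^*%R = expi (- t).
Proof. by rewrite /expi cosN sinN conj_complex. Qed.

Lemma diag_expi_unitary n (d : 'rV[R]_n) :
  diag_mx (map_mx (@expi R) d) \is unitarymx.
Proof.
apply/unitarymxP; rewrite tr_diag_mx map_diag_mx mulmx_diag.
rewrite -diag_const_mx; congr diag_mx; apply/rowP => i.
by rewrite !mxE /= conj_expi -expiD subrr expi0.
Qed.

(** In the eigenbasis, each entry of a partial sum of the exponential is a fixed
    linear combination of partial sums of scalar exponentials at imaginary
    arguments; this gives at once the existence and the value of the limit. *)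
Lemma mexp_skew_unitary n (A : 'M[R[i]]_n.+1) :
  A^t* = - A -> mexp A \is unitarymx.
Proof.
move=> /skew_spectral[P Pu [d AE d_skew]].
have d_imag k : 0 +i* complex.Im (d 0 k) = d 0 k.
  move: (d_skew k); case: (d 0 k) => x y [/eqP].
  by rewrite -addr_eq0 -mulr2n mulrn_eq0 /= => /eqP ->.
pose D := map_mx (fun z => complex.Im z) d.
suff -> : mexp A = P^t* *m diag_mx (map_mx (@expi R) D) *m P.
  exact: unitary_conj (diag_expi_unitary _ _).
rewrite /mexp; apply: cvg_lim; first exact: norm_hausdorff.
apply: cvg_mx => p q.
rewrite unitary_diag_entry.
have -> : (fun N => series (fun k => (k`!%:R : R[i])^-1 *: A ^+ k) N p q) =
  (fun N => \sum_s (P s p)^*%R * P s q *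
     series (fun k => (k`!%:R : R[i])^-1 * (0 +i* D 0 s) ^+ k) N).
  apply/funext => N; rewrite /series /= summxE.
  under [RHS]eq_bigr do rewrite mulr_sumr.
  rewrite exchange_big /=; apply: eq_bigr => k _.
  rewrite mxE AE unitary_diag_expr// unitary_diag_entry mulr_sumr.
  apply: eq_bigr => s _; rewrite [D 0 s]mxE d_imag mulrCA.
  by rewrite [map_mx _ _ 0 s]mxE.
apply: cvg_bigsum => s; rewrite [map_mx (@expi R) D 0 s]mxE.
by apply: cvgMl_tmp; exact: cvg_exp_imag.
Qed.
End MatrixExp.

(** * Squared Frobenius norm and scaled isometries *)

Section Frobenius.
Context {C : numClosedFieldType}.

Definition sqfrob {m n} (X : 'M[C]_(m, n)) : C := \sum_i \sum_j `|X i j| ^+ 2.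

Lemma sqfrobE m n (X : 'M[C]_(m, n)) : sqfrob X = \tr (X^t* *m X).
Proof.
rewrite /sqfrob exchange_big; apply: eq_bigr => j _; rewrite mxE.
by apply: eq_bigr => i _; rewrite !mxE mulrC -normCK.
Qed.

(** The tool shared by the two kinds of substep: unitary exponentials are the
    case c = 1, Fourier synthesis the case c = M, and the discrete Fourier
    transform the case c = 1/M. *)
Lemma sqfrob_scaled_isometry m n p (S : 'M[C]_(m, n)) (c : C)
    (X : 'M[C]_(n, p)) :
  S^t* *m S = c%:M -> sqfrob (S *m X) = c * sqfrob X.
Proof.
move=> SS; rewrite !sqfrobE trmx_mul map_mxM /= -mulmxA [S^t* *m _]mulmxA SS.
by rewrite mul_scalar_mx -scalemxAr mxtraceZ.
Qed.

Lemma sqfrob_unitary n p (S : 'M[C]_n) (X : 'M[C]_(n, p)) :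
  S \is unitarymx -> sqfrob (S *m X) = sqfrob X.
Proof.
move=> /unitarymxP/mulmx1C Su.
by rewrite (sqfrob_scaled_isometry _ _ _ S 1)// mul1r.
Qed.
End Frobenius.

(** * Orthogonality of the discrete Fourier modes *)

Section Fourier.
Context {R : realType}.

Lemma expiX (t : R) n : expi (n%:R * t) = expi t ^+ n.
Proof.
elim: n => [|n IH]; first by rewrite mul0r expi0.
by rewrite -natr1 mulrDl mul1r expiD IH exprSr.
Qed.

(** The half-angle formula cos t = 1 - 2 sin (t/2)^2 reduces this to the
    positivity of the sine on the open interval from 0 to pi. *)
Lemma expi_neq1 (t : R) : 0 < `|t| -> `|t| < 2 * pi -> expi t != 1.
Proof.
move=> t0 t2; apply/eqP => -[cost1 _].
have {cost1} : cos `|t| = 1 by case: ger0P; rewrite ?cosN.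
have -> : `|t| = (`|t| / 2) *+ 2 by rewrite -mulr_natr divfK.
rewrite cos_mulr2n cos2sin2 => cost.
have : sin (`|t| / 2) > 0.
  by apply: sin_gt0_pi; rewrite divr_gt0//= ltr_pdivrMr// mulrC.
move/lt0r_neq0 => s0.
suff : sin (`|t| / 2) ^+ 2 == 0 by rewrite sqrf_eq0 (negPf s0).
apply/eqP; move: cost; lra.
Qed.

Lemma expi_2pi_int (l : int) : expi (2 * pi * l%:~R : R) = 1.
Proof.
have expi2pi : expi (2 * pi : R) = 1.
  by rewrite mulr_natl /expi cos2pi sin2pi.
case: l => n; first by rewrite mulrC expiX expi2pi expr1n.
by rewrite NegzE mulrNz mulrN -conj_expi mulrC expiX expi2pi expr1n conjC1.
Qed.

(** The terms are the powers of an M-th root of unity z, so that the sum times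
    z - 1 vanishes; the bound on l ensures that z = 1 only for l = 0. *)
Lemma sum_expi_orth (M : nat) (l : int) : (`|l| < M)%N ->
  \sum_(j < M) expi (2 * j%:R * l%:~R * pi / M%:R : R) = (M * (l == 0))%:R.
Proof.
move=> ltlM; have M_gt0 : (0 < M)%N := leq_ltn_trans (leq0n _) ltlM.
have [->|l0] := eqVneq l 0.
  under eq_bigr do rewrite mulr0z mulr0 !mul0r expi0.
  by rewrite sumr_const card_ord muln1.
pose t : R := 2 * pi * l%:~R / M%:R.
have tE (j : 'I_M) : 2 * j%:R * l%:~R * pi / M%:R = j%:R * t :> R.
  by rewrite /t; ring.
under eq_bigr do rewrite tE expiX.
rewrite muln0; have : expi t ^+ M - 1 = 0.
  by rewrite -expiX /t mulrC divfK ?expi_2pi_int ?subrr// pnatr_eq0 -lt0n.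
rewrite subrX1 => /eqP; rewrite mulf_eq0 subr_eq0 => /orP[|/eqP//].
have tn : `|t| = 2 * pi * (`|l|%N%:R / M%:R).
  rewrite /t !normrM normfV (ger0_norm (pi_ge0 R)) !normr_nat.
  by rewrite natr_absz intr_norm mulrA.
rewrite (negPf (expi_neq1 _ _ _))// tn.
  by rewrite !mulr_gt0 ?invr_gt0 ?pi_gt0 ?ltr0n ?absz_gt0.
by rewrite gtr_pMr ?mulr_gt0 ?pi_gt0// ltr_pdivrMr ?ltr0n// mul1r ltr_nat.
Qed.

Definition fourier (M : nat) : 'M[R[i]]_M :=
  \matrix_(j, k) expi (2 * j%:R * (freq k)%:~R * pi / M%:R).

Lemma fourier_gram M : (fourier M)^t* *m fourier M = M%:R%:M.
Proof.
apply/matrixP => k l; rewrite !mxE.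
(* The shift by M/2 in the frequencies cancels in their difference. *)
have E (j : 'I_M) : (fourier M)^t* k j * fourier M j l
    = expi (2 * j%:R * (l%:Z - k%:Z)%:~R * pi / M%:R).
  rewrite !mxE /= conj_expi -expiD /freq !intrB; congr expi; ring.
under eq_bigr do rewrite E.
rewrite sum_expi_orth.
  by rewrite subr_eq0 eqz_nat eq_sym -val_eqE; case: eqP; rewrite ?muln1 ?muln0.
have := ltn_ord k; have := ltn_ord l; lia.
Qed.

(** By [fourier_gram], M^-1 F^* is a left inverse of the square matrix F, hence
    also a right inverse. *)
Lemma fourier_cogram M : (0 < M)%N ->
  fourier M *m (fourier M)^t* = M%:R%:M.
Proof.
move=> M_gt0; have M0 : (M%:R : R[i]) != 0 by rewrite pnatr_eq0 -lt0n.
have : M%:R^-1 *: (fourier M)^t* *m fourier M = 1%:M.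
  by rewrite -scalemxAl fourier_gram scale_scalar_mx mulVf.
move/mulmx1C; rewrite -scalemxAr => /(congr1 ( *:%R M%:R)).
by rewrite scalerA mulfV// scale1r scalemx1.
Qed.
End Fourier.

(** * Plancherel identities *)

Section Plancherel.
Context {R : realType}.

Lemma enorm_sqr n (v : 'cV[R[i]]_n) :
  (enorm v ^+ 2)%:C = \sum_i `|v i 0| ^+ 2.
Proof.
rewrite /enorm sqr_sqrtr ?sumr_ge0// => [|i _]; last exact: sqr_ge0.
by rewrite rmorph_sum; apply: eq_bigr => i _; rewrite rmorphXn.
Qed.

Lemma sqfrob_col n (v : 'cV[R[i]]_n) : sqfrob v = (enorm v ^+ 2)%:C.
Proof. by rewrite enorm_sqr; apply: eq_bigr => i _; rewrite big_ord1. Qed.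

Lemma enorm_unitary n (S : 'M[R[i]]_n) (v : 'cV[R[i]]_n) :
  S \is unitarymx -> enorm (S *m v) ^+ 2 = enorm v ^+ 2.
Proof.
by move=> Su; apply: complexI; rewrite -!sqfrob_col sqfrob_unitary.
Qed.

(** The values are rows, so that a Fourier matrix, which acts on the grid index
    separately in each component, multiplies from the left. *)
Definition stack m n (F : 'I_m -> 'cV[R[i]]_n) : 'M[R[i]]_(m, n) :=
  \matrix_(j, p) F j p 0.

Lemma sqfrob_stack m n (F : 'I_m -> 'cV[R[i]]_n) :
  sqfrob (stack m n F) = (\sum_j enorm (F j) ^+ 2)%:C.
Proof.
rewrite rmorph_sum; apply: eq_bigr => j _; rewrite /= enorm_sqr.
by apply: eq_bigr => p _; rewrite mxE.
Qed.

(** The last grid point is the first one modulo the period b - a; the mass and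
    the discrete Fourier transform sum over the others. *)
Definition one_period {M} (U : gridfun R M) (j : 'I_M) : 'cV[R[i]]_2 :=
  U (widen_ord (leqnSn M) j).

Lemma plancherel_dft M (U : gridfun R M) : (0 < M)%N ->
  \sum_(k < M) enorm (dft U (freq k)) ^+ 2
    = M%:R^-1 * \sum_(j < M) enorm (one_period U j) ^+ 2.
Proof.
move=> M_gt0; apply: complexI; rewrite rmorphM -!sqfrob_stack.
have -> : stack M 2 (fun k => dft U (freq k))
    = (M%:R^-1 *: (fourier M)^t*) *m stack M 2 (one_period U).
  rewrite -scalemxAl; apply/matrixP => k p; rewrite !mxE; congr (_ * _).
  rewrite summxE; apply: eq_bigr => j _.
  by rewrite !mxE /= conj_expi.
rewrite (sqfrob_scaled_isometry _ _ _ _ M%:R^-1).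
  by rewrite sqfrob_stack (fmorphV (real_complex R)) rmorph_nat.
rewrite trmxC_scale -scalemxAl -scalemxAr trmxCK fourier_cogram//.
rewrite scalerA scale_scalar_mx fmorphV /= conjC_nat mulfVK//.
by rewrite pnatr_eq0 -lt0n.
Qed.

Lemma plancherel_synthesis M (c : 'I_M -> 'cV[R[i]]_2) :
  \sum_(j < M) enorm (\sum_(k < M)
      expi (2 * j%:R * (freq k)%:~R * pi / M%:R) *: c k) ^+ 2
    = M%:R * \sum_(k < M) enorm (c k) ^+ 2.
Proof.
apply: complexI; rewrite -sqfrob_stack rmorphM rmorph_nat /= -sqfrob_stack.
rewrite -(sqfrob_scaled_isometry _ _ _ _ _ _ (fourier_gram M)).
congr sqfrob; apply/matrixP => j p; rewrite !mxE summxE.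
by apply: eq_bigr => k _; rewrite !mxE.
Qed.
End Plancherel.

(** * The generators of the scheme are skew-Hermitian *)

Section SkewGenerators.
Context {R : realType}.

Lemma conj_real (s : R) : (s%:C : R[i])^*%R = s%:C.
Proof. exact: conjc_real. Qed.

Lemma skew_scale_real n (s : R) (A : 'M[R[i]]_n) :
  A^t* = - A -> (s%:C *: A)^t* = - (s%:C *: A).
Proof. by move=> As; rewrite trmxC_scale As scalerN conj_real. Qed.

Lemma skewD n (A B : 'M[R[i]]_n) :
  A^t* = - A -> B^t* = - B -> (A + B)^t* = - (A + B).
Proof. by move=> As Bs; rewrite trmxC_add As Bs opprD. Qed.

Lemma sigma1_herm : (sigma1 R)^t* = sigma1 R.
Proof.
by apply/matrixP => p q; rewrite !mxE eq_sym; case: eqP; rewrite ?conjC0 ?conjC1.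
Qed.

Lemma sigma3_herm : (sigma3 R)^t* = sigma3 R.
Proof.
apply/matrixP => p q; rewrite !mxE eq_sym; case: eqP => [->|_]; last first.
  by rewrite conjC0.
by case: eqP => _; rewrite ?conjC1 ?rmorphN1.
Qed.

Lemma imag_skew n (s : R) (H : 'M[R[i]]_n) : H^t* = H ->
  (('i * s%:C) *: H)^t* = - (('i * s%:C) *: H).
Proof.
move=> Hh; rewrite trmxC_scale Hh -scaleNr; congr (_ *: _).
by simpc; rewrite conj_complex.
Qed.

Lemma Wmx_skew delta V A1 x : (Wmx (R := R) delta V A1 x)^t* = - Wmx delta V A1 x.
Proof.
have -> : Wmx delta V A1 x = ('i * (- delta^-1)%:C) *:
    ((V x)%:C *: 1%:M + (- A1 x)%:C *: sigma1 R).
  rewrite /Wmx -scaleNr; congr (_ *: (_ + _ *: _)); last by rewrite rmorphN.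
  by rewrite rmorphN fmorphV mulrN.
apply: imag_skew.
by rewrite trmxC_add !trmxC_scale sigma1_herm trmx1 map_mx1 !conj_real.
Qed.

Lemma What_skew eps delta nu tau V A1 x :
  (What (R := R) eps delta nu tau V A1 x)^t* = - What eps delta nu tau V A1 x.
Proof.
rewrite /What -scaleNr -mulrA -rmorphM -mulrN -rmorphN.
apply: skewD; [exact: Wmx_skew|apply: imag_skew; exact: sigma3_herm].
Qed.

Lemma Gamma_skew eps delta nu a b l :
  (Gamma (R := R) eps delta nu a b l)^t* = - Gamma eps delta nu a b l.
Proof.
rewrite /Gamma -!scaleNr -!mulrN -!rmorphN.
apply: skewD; apply: imag_skew; [exact: sigma1_herm|exact: sigma3_herm].
Qed.
End SkewGenerators.

(** * Mass conservation *)

Section Scheme.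
Context {R : realType}.

Lemma potential_step_mass (a b : R) M (s : R) (Q : R -> 'M[R[i]]_2)
    (U : gridfun R M) :
  (forall x, (Q x)^t* = - Q x) ->
  mass a b (potential_step a b s Q U) = mass a b U.
Proof.
move=> Qs; congr (_ * _); apply: eq_bigr => j _.
by rewrite enorm_unitary//; apply/mexp_skew_unitary/skew_scale_real/Qs.
Qed.

Lemma free_step_mass (eps delta nu a b : R) M (s : R) (U : gridfun R M) :
  (0 < M)%N ->
  mass a b (free_step eps delta nu a b s U) = mass a b U.
Proof.
move=> M_gt0; congr (_ * _).
rewrite plancherel_synthesis.
rewrite (eq_bigr (fun k => enorm (dft U (freq k)) ^+ 2)) => [|k _].
  by rewrite plancherel_dft// mulrA mulfV ?mul1r// pnatr_eq0 -lt0n.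
by rewrite enorm_unitary//; apply/mexp_skew_unitary/skew_scale_real/Gamma_skew.
Qed.

Lemma S4c_step_mass eps delta nu a b V A1 M tau (U : gridfun R M) :
  (0 < M)%N -> mass a b (S4c_step eps delta nu a b V A1 tau U) = mass a b U.
Proof.
move=> M_gt0; rewrite /S4c_step.
rewrite potential_step_mass; last exact: Wmx_skew.
rewrite free_step_mass//.
rewrite potential_step_mass; last exact: What_skew.
rewrite free_step_mass//.
by rewrite potential_step_mass; last exact: Wmx_skew.
Qed.

Lemma S4c_mass eps delta nu a b V A1 Phi0 M tau n : (0 < M)%N ->
  mass a b (S4c eps delta nu a b V A1 Phi0 (M := M) tau n)
    = mass a b (fun j : 'I_M.+1 => Phi0 (gridpt (R := R) a b j)).
Proof.
by move=> M_gt0; elim: n => [//|n IH]; rewrite /S4c iterS S4c_step_mass.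
Qed.
End Scheme.

Theorem lemma4p1 (R : realType) (eps delta nu : R)
    (eps_gt0 : 0 < eps) (eps_le1 : eps <= 1)
    (delta_gt0 : 0 < delta) (delta_le1 : delta <= 1)
    (nu_gt0 : 0 < nu) (nu_le1 : nu <= 1)
    (a b : R) (ltab : a < b)
    (V A1 : R -> R) (Phi0 : R -> 'cV[R[i]]_2)
    (Phi0_per : Phi0 a = Phi0 b)
    (dPhi0_per : exists d : 'cV[R[i]]_2,
       is_right_derive Phi0 a d /\ is_left_derive Phi0 b d)
    (M : nat) (M_gt0 : (0 < M)%N) (M_even : ~~ odd M)
    (tau : R) (tau_gt0 : 0 < tau) (n : nat) :
  let h := (b - a) / M%:R in
  let Phi := S4c eps delta nu a b V A1 Phi0 (M := M) tau in
  [/\ mass a b (Phi n.+1)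
        = h * \sum_(j < M) enorm (Phi 0%N (widen_ord (leqnSn M) j)) ^+ 2,
      h * \sum_(j < M) enorm (Phi 0%N (widen_ord (leqnSn M) j)) ^+ 2
        = h * \sum_(j < M) enorm (Phi0 (a + j%:R * h)) ^+ 2
    & h * \sum_(j < M) enorm (Phi0 (a + j%:R * h)) ^+ 2
        = mass a b (fun j : 'I_M.+1 => Phi0 (gridpt a b j))].
Proof. by split=> //; exact: S4c_mass. Qed.
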